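(* Let $X\subset\mathbb{R}^{d_x}$ be a nonempty closed convex set, $Y\subset\mathbb{R}^{d_y}$ a nonempty compact set, and $f:\mathbb{R}^{d_x}\times\mathbb{R}^{d_y}\to\mathbb{R}$ a continuous function such that, for every $y\in Y$, the function $\mathbb{R}^{d_x}\ni x\mapsto f(x,y)$ is coercive and convex. Let $W:=Y^{d_x+1}$, $F(x,w):=\max_{1\le i\le d_x+1}f(x,y_i)$ for $w=(y_1,\dots,y_{d_x+1})\in W$, and $\Phi(x):=\max_{y\in Y}f(x,y)$. Let $w^\ast\in\arg\max_{w\in W}\min_{x\in X}F(x,w)$ and $x^\ast\in\arg\min_{x\in X}F(x,w^\ast)$ be arbitrary. Then $x^\ast$ is a global solution of the original minimax problem, i.e. $x^\ast\in\arg\min_{x\in X}\Phi(x)$, if either of the following conditions holds: (i) $\Phi(\cdot)$ and $F(\cdot,w^\ast)$ have a common unique minimizer over $X$ (in particular, this holds if both $\Phi$ and $F(\cdot,w^\ast)$ are strictly convex on $X$); (ii) the finite tuple $w^\ast$ is exact at $x^\ast$, namely $F(x^\ast,w^\ast)=\Phi(x^\ast)$. Furthermore, suppose $f(\cdot,y)$ is continuously differentiable for every $y\in Y$. If $w^\ast$ is first-order exact at $x^\ast$, namely $\partial_x F(x^\ast,w^\ast)=\partial\Phi(x^\ast)$, then $x^\ast$ is first-order stationary for $\min_{x\in X}F(x,w^\ast)$ if and only if $x^\ast$ is first-order stationary for $\min_{x\in X}\Phi(x)$.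
   Context: Coercive means $f(x,y)\to+\infty$ as $\|x\|\to\infty$ with $y$ fixed. The functions $F(\cdot,w)$ and $\Phi$ are convex; $\partial_xF(x,w)$ and $\partial\Phi(x)$ denote their convex subdifferentials in $x$. $N_X(x)$ denotes the normal cone of $X$ at $x$. A point $x^\ast\in X$ is first-order stationary for $\min_{x\in X}F(x,w^\ast)$ if $0\in\partial_xF(x^\ast,w^\ast)+N_X(x^\ast)$, and first-order stationary for $\min_{x\in X}\Phi(x)$ if $0\in\partial\Phi(x^\ast)+N_X(x^\ast)$. *)

(* Defs.v *)
(* MathComp / MathComp-Analysis; R^n is 'rV[R]_n with R : realType. *)
From HB Require Import structures.
From mathcomp Require Export all_boot all_order all_algebra.
From mathcomp Require Export all_classical all_reals all_analysis.
Export Order.TTheory GRing.Theory Num.Theory.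
Export numFieldNormedType.Exports.

Set Implicit Arguments.
Unset Strict Implicit.
Unset Printing Implicit Defensive.

Local Open Scope classical_set_scope.
Local Open Scope ring_scope.
Local Open Scope convex_scope.

Section Optimization.
Context {R : realType} {T : Type}.
Implicit Types (A : set T) (g : T -> R).

Definition argmin A g : set T := [set x | A x /\ forall z, A z -> g x <= g z].

Definition argmax A g : set T := [set x | A x /\ forall z, A z -> g z <= g x].

(* [min_over] and [max_over] are the least and greatest values of [g] on [A]
   when these are attained. [inf] and [sup] are total, with value 0 on empty or
   unbounded sets. *)
Definition min_over A g : R := inf (g @` A).

Definition max_over A g : R := sup (g @` A).

Definition common_unique_minimizer A g h : Prop :=
  exists x0, argmin A g = [set x0] /\ argmin A h = [set x0].

End Optimization.

Section ConvexAnalysis.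
Context {R : realType} {n : nat}.
Local Notation E := 'rV[R]_n.
Implicit Types (X : set E) (g : E -> R) (x u v : E).

(* [`|x|] is the sup norm; all norms on R^n give the same notion. *)
Definition coercive g : Prop :=
  forall M : R, exists r : R, forall x, r <= `|x| -> M <= g x.

(* The strict counterpart of [convex_function]. *)
Definition strictly_convex_function (X : set (convex_lmodType E))
    (g : convex_lmodType E -> R^o) : Prop :=
  forall t : {i01 R}, 0 < t%:num -> t%:num < 1 ->
    {in X &, forall x y : convex_lmodType E,
      x != y -> (g (x <| t |> y) < g x <| t |> g y)%R}.

Definition dot u v : R := \sum_(i < n) u 0 i * v 0 i.

Definition subdifferential g x : set E :=
  [set v | forall z, g x + dot v (z - x) <= g z].

Definition normal_cone X x : set E :=
  [set v | X x /\ forall z, X z -> dot v (z - x) <= 0].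

Definition set_add (A B : set E) : set E := [set a + b | a in A & b in B].

Definition first_order_stationary X g x : Prop :=
  X x /\ set_add (subdifferential g x) (normal_cone X x) 0.

(* In finite dimension, the differential is continuous iff every directional
   derivative is. *)
Definition continuously_differentiable g : Prop :=
  (forall x, differentiable g x) /\ (forall v, continuous ('D_v g)).

End ConvexAnalysis.

Section Minimax.
Context {R : realType} {dx dy : nat}.
Local Notation Ex := 'rV[R]_dx.
Local Notation Ey := 'rV[R]_dy.
Implicit Types (Y : set Ey) (f : Ex -> Ey -> R) (w : 'I_dx.+1 -> Ey).

Definition tuples_in Y : set ('I_dx.+1 -> Ey) := [set w | forall i, Y (w i)].

(* The neutral element of the big operator is one of the maximized values. *)
Definition Fmax f w (x : Ex) : R :=
  \big[Num.max/f x (w ord0)]_(i < dx.+1) f x (w i).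

Definition Phi Y f (x : Ex) : R := max_over Y (f x).

End Minimax.

(* Main.v *)
Require Import Defs.
From mathcomp Require Import lra.

(** Every entry of [w] lies in [Y], so [F(.,w) <= Phi] everywhere, with
    [F(.,w) = Fmax f w]. This comparison settles the first conclusion: under
    exactness, [Phi x = F(x,w) <= F(z,w) <= Phi z] for every [z] in [X]; and if
    the two functions have the same single minimizer, that minimizer is [x].
    The conclusion on stationarity holds because stationarity of [x] sees the
    objective only through its subdifferential at [x].

    That strict convexity gives a common minimizer is the substantial part, and
    the only place where the number [dx + 1] of entries matters. Let [v] be the
    value [F(x,w)], which is the maximum over tuples [w'] of
    [min_X F(.,w')]. For [c > v], any [dx + 1] of the compact convex sets
    [X `&` {f(.,y) <= c}] have a common point, since a tuple [w'] picking these
    sets has [inf_X F(.,w') <= v < c]. By Helly's theorem in dimension [dx]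
    (lemma [helly_compact], deduced from Radon's theorem [radon]), all these
    sets, for all [y] in [Y] and all [c > v], share a point [x0]; hence
    [Phi x0 <= v] (lemma [minimax_tuples]). Now [v <= F(x0,w) <= Phi x0 <= v],
    so [x0] minimizes [F(.,w)], and it minimizes [Phi] because
    [Phi >= F(.,w) >= v] on [X]. Strict convexity makes both minimizers
    unique (lemma [argmin_strictly_convex]). *)

Set Implicit Arguments.
Unset Strict Implicit.
Unset Printing Implicit Defensive.

Local Open Scope classical_set_scope.
Local Open Scope ring_scope.

(** * Theorems of Radon and Helly *)

Section Helly.
Context {R : realType} {n : nat}.
Local Notation E := 'rV[R]_n.
Implicit Types K : set E.

(** The cone over a convex set is stable under addition. Writing the result as
    a multiple of a point of [K], rather than dividing by [s + t], lets both
    weights vanish, so that sums of weighted points need no case analysis. *)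
Lemma convex_set_addZ K (s t : R) (u v : E) : convex_set K ->
  0 <= s -> 0 <= t -> K u -> K v ->
  exists2 q, K q & s *: u + t *: v = (s + t) *: q.
Proof.
move=> cK s0 t0 Ku Kv; have [st0|st0] := eqVneq (s + t) 0.
  exists u => //; have [-> ->] : s = 0 /\ t = 0 by split; lra.
  by rewrite addr0 !scale0r addr0.
have st_gt0 : 0 < s + t by rewrite lt0r st0 addr_ge0.
have ge0l : 0 <= s / (s + t) by rewrite divr_ge0 // ltW.
have le1l : s / (s + t) <= 1 by rewrite ler_pdivrMr // mul1r lerDl.
pose l : {i01 R} := Itv01 ge0l le1l.
exists (l%:num *: u + (1 - l%:num) *: v).
  by have := cK u v l; rewrite !inE; apply.
rewrite scalerDr !scalerA /= mulrBr mulr1 mulrCA divff // mulr1.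
by rewrite [s + t]addrC addrK.
Qed.

Lemma convex_set_sumZ K (I : finType) (P : pred I) (a : I -> R) (p : I -> E) :
  convex_set K -> K !=set0 -> (forall i, P i -> 0 <= a i) ->
  (forall i, P i -> K (p i)) ->
  exists2 q, K q & \sum_(i | P i) a i *: p i = (\sum_(i | P i) a i) *: q.
Proof.
move=> cK [q0 Kq0] a0 Kp.
suff [] : 0 <= \sum_(i | P i) a i /\ exists2 q, K q &
  \sum_(i | P i) a i *: p i = (\sum_(i | P i) a i) *: q by [].
pose C (s : R) (v : E) := 0 <= s /\ exists2 q, K q & v = s *: q.
apply: (big_ind2 C) => [|s u t v [s0 [q Kq ->]] [t0 [r Kr ->]]|i Pi].
- by split=> //; exists q0; rewrite ?scale0r.
- by split; [exact: addr_ge0 | exact: convex_set_addZ].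
- by split; [exact: a0 | exists (p i); first exact: Kp].
Qed.

(** The rows [(1, p i)] live in dimension [n + 1], so more than [n + 1] of them
    are linearly dependent; the leading 1 is what forces [\sum_i a i = 0]. *)
Lemma affine_dependence m (p : 'I_m -> E) : (n.+1 < m)%N ->
  exists a : 'I_m -> R,
    [/\ exists i, a i != 0, \sum_i a i = 0 & \sum_i a i *: p i = 0].
Proof.
move=> nm; pose M : 'M[R]_(m, 1 + n) := row_mx (const_mx 1) (\matrix_i p i).
have : kermx M != 0.
  rewrite kermx_eq0 -row_leq_rank -ltnNge.
  by apply: leq_ltn_trans (rank_leq_col M) _.
move=> /rowV0Pn[v /sub_kermxP vM v0]; exists (v 0).
move: vM; rewrite mul_mx_row => vM.
have [v1 vp] := eq_row_mx (etrans vM (esym (row_mx0 _ _ _ _))); split.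
- by have /rV0Pn := v0.
- move/matrixP: v1 => /(_ 0 0); rewrite !mxE => v1; rewrite -[RHS]v1.
  by apply: eq_bigr => i _; rewrite mxE mulr1.
- rewrite -[RHS]vp mulmx_sum_row; apply: eq_bigr => i _.
  by rewrite rowK.
Qed.

(** Radon's theorem: the points split into two classes whose convex hulls meet
    at [z]. Membership of [z] in a convex hull is expressed as membership in
    every convex set that contains the points of the class.
    The classes are given by the sign of the coefficients [a] of an affine
    dependence: moving the nonpositive terms to the other side shows that the
    two classes have the same total weight [s] and the same weighted sum [v],
    so that [z = v / s] is a convex combination of either of them. *)
Lemma radon m (p : 'I_m -> E) : (n.+1 < m)%N ->
  exists (A : pred 'I_m) (z : E), forall K, convex_set K ->
    ((forall i, A i -> K (p i)) -> K z) /\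
    ((forall i, ~~ A i -> K (p i)) -> K z).
Proof.
move=> /(affine_dependence p)[a [[i0 ai0] sum_a sum_ap]].
pose A i := 0 < a i; exists A.
pose s := \sum_(i | A i) a i; pose v := \sum_(i | A i) a i *: p i.
have sN : \sum_(i | ~~ A i) - a i = s.
  by rewrite sumrN; apply/esym/eqP; rewrite -addr_eq0 -[eqbRHS]sum_a [eqbRHS](bigID A).
have vN : \sum_(i | ~~ A i) - a i *: p i = v.
  rewrite (eq_bigr (fun i => - (a i *: p i))) => [|i _]; last exact: scaleNr.
  by rewrite sumrN; apply/esym/eqP; rewrite -addr_eq0 -[eqbRHS]sum_ap [eqbRHS](bigID A).
have Na_ge0 i : ~~ A i -> 0 <= - a i by rewrite -leNgt oppr_ge0.
have a_ge0 i : A i -> 0 <= a i by move/ltW.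
(* If [s] were 0, the coefficients of both classes would all vanish. *)
have s_gt0 : 0 < s.
  rewrite lt0r sumr_ge0 // andbT; apply: contra ai0 => /eqP s0.
  have [Ai0|NAi0] := boolP (A i0).
    have /eqP := s0; rewrite psumr_eq0 // => /allP/(_ i0).
    by rewrite mem_index_enum Ai0 => /(_ isT).
  have /eqP := sN; rewrite s0 psumr_eq0 // => /allP/(_ i0).
  by rewrite mem_index_enum NAi0 oppr_eq0 => /(_ isT).
have sV q : s *: q = v -> s^-1 *: v = q.
  by move=> <-; rewrite scalerA mulVf ?scale1r // gt_eqF.
have nonempty (P : pred 'I_m) (b : 'I_m -> R) K : \sum_(i | P i) b i = s ->
    (forall i, P i -> K (p i)) -> K !=set0.
  move=> sb KP; have [i Pi|P0] := pickP P; first by exists (p i); exact: KP.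
  by move: s_gt0; rewrite -sb big_pred0 // ltxx.
exists (s^-1 *: v) => K cK; split=> KP.
- have [q Kq /esym/sV -> //] :=
    convex_set_sumZ cK (nonempty _ a _ erefl KP) a_ge0 KP.
- have [q Kq] := convex_set_sumZ cK (nonempty _ _ _ sN KP) Na_ge0 KP.
  by rewrite sN vN => /esym/sV ->.
Qed.

(** Helly's theorem for a finite family, by induction on its size. Given more
    than [n + 1] sets, let [p j] be a point common to all of them but the
    [j]-th. The Radon point of the [p j] belongs to each [K (w i)], because the
    class which does not contain [i] has all its points in [K (w i)].
    The subfamilies are indexed by tuples, which may repeat an index. *)
Lemma helly_finite (I : Type) (K : I -> set E) : (forall i, convex_set (K i)) ->
  (forall w : 'I_n.+1 -> I, exists z, forall j, K (w j) z) ->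
  forall m (w : 'I_m -> I), exists z, forall j, K (w j) z.
Proof.
move=> cK small; elim=> [|m IH] w; first by exists 0 => -[].
have [mn|nm] := leqP m n.
  (* A family of at most [n + 1] sets is completed to a tuple by repetition:
     [inord] sends the indices out of range to 0. *)
  have [z Kz] := small (fun j => w (inord j)); exists z => j.
  have jn : (j < n.+1)%N by exact: leq_trans (ltn_ord j) _.
  by have := Kz (Ordinal jn); rewrite /= inord_val.
have /choice[p Kp] (j : 'I_m.+1) : exists z, forall i, i != j -> K (w i) z.
  have [z Kz] := IH (fun i => w (lift j i)); exists z => i ij.
  by rewrite eq_sym in ij; have [k -> _] := unlift_some ij; exact: Kz.
have [A [z Az]] := radon p (nm : (n.+1 < m.+1)%N); exists z => i.
have [KA KNA] := Az _ (cK (w i)).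
have [Ai|NAi] := boolP (A i).
- by apply: KNA => j NAj; apply: Kp; apply: contraNneq NAj => <-.
- by apply: KA => j Aj; apply: Kp; apply: contraNneq NAi => ->.
Qed.

(** For an arbitrary family of compact sets, finite subfamilies intersect by
    [helly_finite], and compactness of one member [K i0] concludes. *)
Lemma helly_compact (I : choiceType) (D : set I) (K : I -> set E) :
  D !=set0 -> (forall i, D i -> convex_set (K i)) ->
  (forall i, D i -> compact (K i)) ->
  (forall w : 'I_n.+1 -> I, (forall j, D (w j)) ->
    exists z, forall j, K (w j) z) ->
  \bigcap_(i in D) K i !=set0.
Proof.
move=> [i0 Di0] cK cptK small.
have fin m (w : 'I_m -> I) : (forall j, D (w j)) -> exists z, forall j, K (w j) z.
  move=> Dw.
  (* Only the indices in [D] carry convex sets, hence the family over the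
     subtype of [D]. *)
  have cK' (i : {i | D i}) : convex_set (K (sval i)).
    by apply: cK; exact: svalP.
  have [|z Kz] := helly_finite cK' _ (fun j => exist _ (w j) (Dw j)).
    by move=> w'; apply: small => j; exact: svalP.
  by exists z.
have := cptK _ Di0; rewrite compact_In0.
move=> /(_ I D (fun i => K i0 `&` K i))[].
- exists K => // i Di; apply: compact_closed; [exact: norm_hausdorff|exact: cptK].
- move=> F FD; pose s := i0 :: finmap.enum_fset F.
  have [|z Kz] := fin _ (fun j : 'I_(size s) => nth i0 s j).
    move=> j; have := mem_nth i0 (ltn_ord j); rewrite inE => /predU1P[->//|].
    by move=> /FD; rewrite inE.
  have Ks i : i \in s -> K i z.
    move=> si; have := Kz (Ordinal (etrans (index_mem i s) si)).
    by rewrite /= nth_index.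
  by exists z => i /= Fi; split; apply: Ks; rewrite inE ?eqxx ?Fi ?orbT.
- by move=> z Kz; exists z => i Di; case: (Kz i Di).
Qed.

End Helly.

(** * Partial maps, minimizers and sublevel sets *)

Section PartialMaps.
Context {U V W : topologicalType} (f : U -> V -> W).

Lemma continuous_partialr u :
  continuous (fun p : U * V => f p.1 p.2) -> continuous (f u).
Proof.
move=> cf v; apply: (@continuous_comp _ _ _ (pair u) (fun p => f p.1 p.2)).
  exact: (cvg_pair (cvg_cst u) cvg_id).
exact: cf.
Qed.

Lemma continuous_partiall v :
  continuous (fun p : U * V => f p.1 p.2) -> continuous (f ^~ v).
Proof.
move=> cf u; apply: (@continuous_comp _ _ _ (pair^~ v) (fun p => f p.1 p.2)).
  exact: (cvg_pair cvg_id (cvg_cst v)).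
exact: cf.
Qed.

End PartialMaps.

Section Minimizers.
Context {R : realType} {n : nat}.
Local Notation E := 'rV[R]_n.
Implicit Types (X : set E) (g : E -> R).

Lemma min_over_argmin X g x : argmin X g x -> min_over X g = g x.
Proof.
move=> [Xx gx]; apply/eqP; rewrite eq_le; apply/andP; split.
  by apply: ge_inf; [exists (g x) => _ [z Xz <-]; exact: gx | exists x].
by apply: lb_le_inf; [exists (g x), x | move=> _ [z Xz <-]; exact: gx].
Qed.

(** A second minimizer [z] would make the midpoint of [x] and [z], which lies in
    [X], strictly better than both. *)
Lemma argmin_strictly_convex X g x : convex_set X ->
  strictly_convex_function X g -> argmin X g x -> argmin X g = [set x].
Proof.
move=> cX cg [Xx gx]; apply/seteqP; split => [z [Xz gz]|_ -> //] /=.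
apply/eqP/negP => /negP zx.
have ge0h : 0 <= 2^-1 :> R by rewrite invr_ge0.
have le1h : 2^-1 <= 1 :> R by rewrite invf_le1 // ler1n.
pose h : {i01 R} := Itv01 ge0h le1h.
have h0 : 0 < h%:num by rewrite /= invr_gt0.
have h1 : h%:num < 1 by rewrite /= invf_lt1 // ltr1n.
have := cX z x h; rewrite !inE => /(_ Xz Xx)/gx.
have := cg h h0 h1 z x; rewrite !inE => /(_ Xz Xx zx).
rewrite convRE /=; have := gz _ Xx; have := gx _ Xz; rewrite /unstable.onem; lra.
Qed.

Lemma convex_sublevel X g c : convex_set X ->
  convex_function [set: E] g -> convex_set (X `&` [set x | g x <= c]).
Proof.
move=> cX cg x y l; rewrite !inE => -[Xx gx] [Xy gy]; split.
  by have := cX x y l; rewrite !inE; apply.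
apply: le_trans (cg l x y _ _) _; rewrite ?inE //.
have ge0l : 0 <= l%:num by [].
have le1l : l%:num <= 1 by [].
move: gx gy; rewrite /= convRE /= /unstable.onem; nra.
Qed.

(** Coercivity with the bound [c + 1] keeps the sublevel set of level [c] inside
    a ball. *)
Lemma compact_sublevel X g c : closed X -> continuous g -> coercive g ->
  compact (X `&` [set x | g x <= c]).
Proof.
move=> clX cg /(_ (c + 1))[r gr]; apply: bounded_closed_compact.
  exists r; split; first exact: num_real.
  move=> s rs x [_ gx] /=; rewrite leNgt; apply/negP => sx.
  have /gr : r <= `|x| by rewrite (le_trans (ltW rs)) // ltW.
  by move: gx => /=; lra.
apply: closedI => //; apply: (@preimage_closed _ _ g [set t | t <= c]).
  by move=> x _; exact: cg.
exact: closed_le.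
Qed.

End Minimizers.

(** * Tuples and the minimax value *)

Section Minimax.
Context {R : realType} {dx dy : nat}.
Implicit Types (X : set 'rV[R]_dx) (Y : set 'rV[R]_dy).
Implicit Types (f : 'rV[R]_dx -> 'rV[R]_dy -> R).

Lemma Fmax_leP f w x c : reflect (forall i, f x (w i) <= c) (Fmax f w x <= c).
Proof.
apply: (iffP (bigmax_leP _ _ _ _)) => [[_ fc] i|fc]; first exact: fc.
by split=> [|i _]; exact: fc.
Qed.

(** Compactness enters because [Phi] is a total supremum, which is an upper
    bound only of bounded sets of values. *)
Lemma le_Phi Y f x y : compact Y -> continuous (f x) -> Y y ->
  f x y <= Phi Y f x.
Proof.
move=> cptY cf Yy; apply: sup_upper_bound; last by exists y.
apply: compact_has_sup; first by exists (f x y), y.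
by apply: continuous_compact => //; exact: continuous_subspaceT.
Qed.

Lemma Phi_le Y f x c : Y !=set0 -> (forall y, Y y -> f x y <= c) ->
  Phi Y f x <= c.
Proof.
move=> [y Yy] fc; apply: ge_sup; first by exists (f x y), y.
by move=> _ [y' Yy' <-]; exact: fc.
Qed.

Lemma Fmax_le_Phi Y f w x : compact Y -> continuous (f x) -> tuples_in Y w ->
  Fmax f w x <= Phi Y f x.
Proof. by move=> cptY cf Yw; apply/Fmax_leP => i; exact: le_Phi. Qed.

(** The value of the minimax problem does not exceed that of its restrictions to
    [dx + 1] values of [y]. Sublevel sets are taken at all levels above [v], and
    not at [v] itself, because an infimum at most [v] yields points of value
    less than any [c > v] without having to be attained. *)
Lemma minimax_tuples X Y f v : X !=set0 -> closed X -> convex_set X ->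
  Y !=set0 -> (forall y, Y y -> continuous (f ^~ y)) ->
  (forall y, Y y -> coercive (f ^~ y)) ->
  (forall y, Y y -> convex_function [set: 'rV[R]_dx] (f ^~ y)) ->
  (forall w, tuples_in Y w -> min_over X (Fmax f w) <= v) ->
  exists2 x, X x & Phi Y f x <= v.
Proof.
move=> X0 clX cX [y0 Yy0] ctf cof cvf le_v.
pose D : set ('rV[R]_dy * R) := [set i | Y i.1 /\ v < i.2].
pose K (i : 'rV[R]_dy * R) := X `&` [set x | f x i.1 <= i.2].
have [|||w Dw|x Kx] := @helly_compact R dx _ D K.
- by exists (y0, v + 1); split=> //=; rewrite ltrDl.
- by move=> i [Yi _]; apply: convex_sublevel => //; exact: cvf.
- by move=> i [Yi _]; apply: compact_sublevel; [|exact: ctf|exact: cof].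
- (* The sets selected by [w] may have different levels; the least works. *)
  pose c := \big[Num.min/(w ord0).2]_j (w j).2.
  have cw j : c <= (w j).2 by exact: (bigmin_le _ j).
  have vc : v < c.
    by apply/bigmin_gtP; split=> [|j _]; [case: (Dw ord0) | case: (Dw j)].
  have Yw : tuples_in Y (fst \o w) by move=> j; case: (Dw j).
  have [|_ [x Xx <-] Fxc] := inf_lt _ (le_lt_trans (le_v _ Yw) vc).
    exact: image_nonempty.
  exists x => j; split=> //=; have /Fmax_leP/(_ j) := ltW Fxc.
  by move/le_trans; apply.
have Kx1 : K (y0, v + 1) x by apply: Kx; split=> //=; rewrite ltrDl.
exists x; first by case: Kx1.
apply: Phi_le; first by exists y0.
move=> y Yy; apply/ler_addgt0Pr => e e0.
by case: (Kx (y, v + e)) => //; split=> //=; rewrite ltrDl.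
Qed.

End Minimax.

Theorem proposition2p4 (R : realType) (dx dy : nat)
  (X : set 'rV[R]_dx) (Y : set 'rV[R]_dy) (f : 'rV[R]_dx -> 'rV[R]_dy -> R)
  (X_nonempty : X !=set0) (X_closed : closed X) (X_convex : convex_set X)
  (Y_nonempty : Y !=set0) (Y_compact : compact Y)
  (f_continuous : continuous (fun p : 'rV[R]_dx * 'rV[R]_dy => f p.1 p.2))
  (f_coercive : forall y, Y y -> coercive (f ^~ y))
  (f_convex : forall y, Y y -> convex_function [set: 'rV[R]_dx] (f ^~ y))
  (w : 'I_dx.+1 -> 'rV[R]_dy) (x : 'rV[R]_dx)
  (w_argmax : argmax (tuples_in Y) (fun w' => min_over X (Fmax f w')) w)
  (x_argmin : argmin X (Fmax f w) x) :
  [/\ common_unique_minimizer X (Phi Y f) (Fmax f w)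
        \/ Fmax f w x = Phi Y f x ->
      argmin X (Phi Y f) x,
      strictly_convex_function X (Phi Y f) ->
      strictly_convex_function X (Fmax f w) ->
      common_unique_minimizer X (Phi Y f) (Fmax f w)
    & (forall y, Y y -> continuously_differentiable (f ^~ y)) ->
      subdifferential (Fmax f w) x = subdifferential (Phi Y f) x ->
      (first_order_stationary X (Fmax f w) x <->
       first_order_stationary X (Phi Y f) x)].
Proof.
have [Yw w_max] := w_argmax.
have f_cty z : continuous (f z).
  exact: (@continuous_partialr 'rV_dx 'rV_dy R f).
have f_ctx y : continuous (f ^~ y).
  exact: (@continuous_partiall 'rV_dx 'rV_dy R f).
have FPhi z : Fmax f w z <= Phi Y f z by exact: Fmax_le_Phi.
split.
- case=> [[x0 [PhiE FE]]|exact_x].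
    by move: x_argmin; rewrite FE PhiE.
  have [Xx Fx] := x_argmin; split=> // z Xz.
  by rewrite -exact_x (le_trans (Fx z Xz)).
- move=> sPhi sF.
  have [x0 Xx0 Phix0] : exists2 x0, X x0 & Phi Y f x0 <= Fmax f w x.
    by apply: minimax_tuples => // w' Yw'; rewrite -(min_over_argmin x_argmin);
      exact: w_max.
  have Fx z : X z -> Fmax f w x <= Fmax f w z by case: x_argmin => _; exact.
  exists x0; split; apply: argmin_strictly_convex => //; split=> // z Xz.
    by rewrite (le_trans Phix0) // (le_trans (Fx z Xz)).
  by rewrite (le_trans (FPhi x0)) // (le_trans Phix0) // Fx.
- by move=> _ subE; rewrite /first_order_stationary subE.
Qed.
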